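(* Let $m\le n$ be positive integers and let $\lambda=(\lambda_1\ge\lambda_2\ge\cdots\ge\lambda_m\ge 0)$ be a dominant integral weight of $GL(m,\mathbb{C})$ (with nonnegative integer entries) such that $|\lambda|\le m$. Then $$\dim\left({}_{m}F^{\lambda}\right)^{S_{m}}=\dim\left({}_{n}F^{\lambda}\right)^{S_{n}}.$$
   Context: ''Dominant'' weights are weakly decreasing sequences of nonnegative integers, i.e. partitions; $|\lambda|=\sum_i\lambda_i$. For a partition $\lambda$ with at most $n$ nonzero parts, ${}_nF^\lambda$ is the irreducible polynomial representation of $GL(n,\mathbb{C})$ with highest weight $\lambda$ padded by zeros to length $n$ (with character the Schur polynomial $s_\lambda(z_1,\dots,z_n)$). $S_n$ is regarded as the subgroup of permutation matrices of $GL(n,\mathbb{C})$, and $M^{S_n}$ denotes the $S_n$-invariants of a module $M$. *)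

(* Defs.v *)
From mathcomp Require Import all_boot all_order all_fingroup all_algebra.
From mathcomp Require Import reals complex mpoly.

Set Implicit Arguments.
Unset Strict Implicit.
Unset Printing Implicit Defensive.

Import GRing.Theory.
Local Open Scope ring_scope.

Section GLRepr.
Variables (F : fieldType) (n : nat) (V : vectType F).

(* As for mx_repr, a representation of GL(n, F) on V is a total function on
   square matrices; only its values at invertible matrices are ever used. *)
Implicit Types (rho : 'M[F]_n -> 'End(V)) (lam : seq nat).

Definition GL_repr rho : Prop :=
  rho 1%:M = \1%VF
  /\ {in unitmx &, forall g h, rho (g *m h) = (rho g \o rho h)%VF}.

(* Every matrix coefficient is a polynomial in the n * n entries of g. *)
Definition GL_polynomial rho : Prop :=
  forall (f : 'Hom(V, F^o)) (v : V), exists p : {mpoly F[n * n]},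
    {in unitmx, forall g : 'M[F]_n, f (rho g v) = p.@[fun k => mxvec g 0 k]}.

Definition GL_stable rho (U : {vspace V}) : Prop :=
  {in unitmx, forall g, (rho g @: U <= U)%VS}.

Definition GL_irreducible rho : Prop :=
  fullv != 0%VS :> {vspace V}
  /\ forall U : {vspace V}, GL_stable rho U -> U = 0%VS \/ U = fullv.

(* The use of nth pads lam by zeros to length n. *)
Definition weight_vector rho lam (v : V) : Prop :=
  forall t : 'rV[F]_n, (forall i, t 0 i != 0) ->
    rho (diag_mx t) v = (\prod_(i < n) t 0 i ^+ nth 0%N lam i) *: v.

(* is_trig_mx is lower triangularity, hence the explicit condition. *)
Definition upper_unipotent (u : 'M[F]_n) : Prop :=
  forall i j : 'I_n, (j <= i)%N -> u i j = (i == j)%:R.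

Definition highest_weight rho lam : Prop :=
  exists v : V, [/\ v != 0, weight_vector rho lam v
    & forall u, upper_unipotent u -> rho u v = v].

(* rho is a model of the irreducible polynomial representation of GL(n, F) of
   highest weight lam, which is unique up to isomorphism in characteristic 0. *)
Definition irr_poly_repr rho lam : Prop :=
  [/\ GL_repr rho, GL_polynomial rho, GL_irreducible rho
    & highest_weight rho lam].

Definition Sn_invariants rho : {vspace V} :=
  (\bigcap_(s : 'S_n) fixedSpace (rho (perm_mx s)))%VS.

End GLRepr.

(* Main.v *)
(** The representations extend polynomially to the monoid of all matrices. Let
    E = diag(1_m, 0) and let W be the representation of GL(n). Since
    E A E is the upper left m x m block of A, the image of E on W is an
    irreducible representation of M_m with highest weight lam, hence a copy of
    the representation V of GL(m): the matrix coefficient of the highest weight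
    vectors is determined by lam on the dense set of products LDU.
    Finally E maps W^{S_n} to (E W)^{S_m} and sum_s sigma(s) maps (E W)^{S_m} to
    W^{S_n}; both maps are injective. For the first, every weight of W has degree
    |lam| <= m, so it is supported in at most m coordinates, which a permutation
    moves into {1, ..., m}. For the second, applying the idempotent of a coordinate
    set A to the sum gives, by induction on |A|, a positive multiple of its
    application to the original vector. *)

Require Import Defs.
From mathcomp Require Import all_boot all_order all_fingroup all_algebra.
From mathcomp Require Import reals complex mpoly.
From HB Require Import structures.
From mathcomp Require boolp.

Set Implicit Arguments.
Unset Strict Implicit.
Unset Printing Implicit Defensive.

Import GRing.Theory.
Local Open Scope ring_scope.

(** * Polynomial functions and vector spaces *)

Section Polynomials.
Variable F : numFieldType.

Lemma horner0_eq0 (p : {poly F}) : (forall s, p.[s] = 0) -> p = 0.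
Proof.
move=> p0; apply/eqP; apply: contraT => pn0.
have := max_poly_roots (rs := [seq i%:R | i <- iota 0 (size p)]) pn0.
rewrite size_map size_iota ltnn => -> //; first by apply/allP => x _; apply/rootP.
rewrite map_inj_uniq ?iota_uniq // => i j /eqP.
by rewrite Num.Theory.eqr_nat => /eqP.
Qed.

Lemma horner_generic_eq (d p q : {poly F}) :
  d != 0 -> (forall s, d.[s] != 0 -> p.[s] = q.[s]) -> p = q.
Proof.
move=> dn0 pq; apply/eqP; rewrite -subr_eq0.
have /eqP : d * (p - q) = 0.
  apply: horner0_eq0 => s; rewrite !hornerE.
  have [->|/pq ->] := eqVneq d.[s] 0; first by rewrite mul0r.
  by rewrite subrr mulr0.
by rewrite mulf_eq0 (negPf dn0).
Qed.

(** The index [k] records a lower bound for the order of vanishing at 0. Orders add under products,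
    and comparing them with a degree is what kills weights of large support. *)
Definition polyfun k (h : F -> F) := exists q : {poly F}, forall s, h s = s ^+ k * q.[s].

Lemma eq_polyfun k h h' : h =1 h' -> polyfun k h -> polyfun k h'.
Proof. by move=> E [q Hq]; exists q => s; rewrite -E. Qed.

Lemma polyfunM k l h h' : polyfun k h -> polyfun l h' ->
  polyfun (k + l) (fun s => h s * h' s).
Proof.
by move=> [p Hp] [q Hq]; exists (p * q) => s; rewrite Hp Hq hornerM exprD mulrACA.
Qed.

Lemma polyfun_sum k (I : finType) (h : I -> F -> F) :
  (forall i, polyfun k (h i)) -> polyfun k (fun s => \sum_i h i s).
Proof.
case/fin_all_exists=> q Hq; exists (\sum_i q i) => s.
by rewrite horner_sum mulr_sumr; apply: eq_bigr.
Qed.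

Lemma polyfun_diff h : polyfun 0 h -> polyfun 1 (fun s => h s - h 0).
Proof.
case=> q Hq.
have /factor_theorem[r Er] : root (q - (q.[0])%:P) 0.
  by rewrite rootE !hornerE subrr.
exists r => s; rewrite !Hq !mul1r mulrC; move/(congr1 (horner^~ s)): Er.
by rewrite !hornerE subr0.
Qed.

Lemma polyfun_generic_eq (d : {poly F}) h h' : polyfun 0 h -> polyfun 0 h' ->
  d != 0 -> (forall s, d.[s] != 0 -> h s = h' s) -> h =1 h'.
Proof.
move=> [p Hp] [q Hq] dn0 E s; rewrite Hp Hq; congr (_ * _.[_]).
by apply: horner_generic_eq dn0 _ => t /E; rewrite Hp Hq !mul1r.
Qed.

End Polynomials.

Section Vectors.
Variables (F : fieldType) (V : vectType F).

(** Vectors satisfying [P] are adjoined one at a time; the codimension drops at each step, so this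
    stops. Excluded middle decides whether such a vector is left. *)
Lemma vspace_of_closed (P : V -> Prop) :
  P 0 -> (forall a x y, P x -> P y -> P (a *: x + y)) ->
  exists U : {vspace V}, forall x, x \in U <-> P x.
Proof.
move=> P0 PD.
suff H k : forall U : {vspace V}, (\dim {:V} - \dim U <= k)%N ->
    (forall x, x \in U -> P x) -> exists U : {vspace V}, forall x, x \in U <-> P x.
  by apply: (H _ 0%VS (leqnn _)) => x; rewrite memv0 => /eqP ->.
elim: k => [|k IH] U dU UP.
  exists U => x; split; first exact: UP.
  have /eqP -> : U == fullv by rewrite eqEdim subvf -subn_eq0 -leqn0.
  by rewrite memvf.
have [[x [Px xU]]|noP] := boolp.EM (exists x, P x /\ x \notin U); last first.
  exists U => x; split; first exact: UP.
  by move=> Px; apply: contraT => xU; case: noP; exists x.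
apply: (IH (<[x]> + U)%VS).
  rewrite leq_subLR -ltnS -addnS (leq_trans _ (_ : \dim U + k.+1 < _)%N) //.
    by rewrite ltnS -leq_subLR.
  rewrite ltn_add2r; apply: contraR xU; rewrite -leqNgt => le.
  have /eqP -> : U == (<[x]> + U)%VS by rewrite eqEdim addvSr le.
  by rewrite (subvP (addvSl _ _)) // memv_line.
by move=> _ /memv_addP[_ /vlineP[a ->] [y /UP Py ->]]; apply: PD.
Qed.

Definition vcoord (i : 'I_(\dim {:V})) : 'Hom(V, F^o) := linfun (coord (vbasis {:V}) i : V -> F^o).

Lemma vcoord_sum x : x = \sum_i vcoord i x *: (vbasis {:V})`_i.
Proof.
rewrite {1}(coord_vbasis (memvf x)).
by apply: eq_bigr => i _; rewrite lfunE.
Qed.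

Lemma functional_eq (x y : V) : (forall f : 'Hom(V, F^o), f x = f y) -> x = y.
Proof.
by move=> E; rewrite (vcoord_sum x) (vcoord_sum y); apply: eq_bigr => i _; rewrite E.
Qed.

Lemma exists_functional (x : V) : x != 0 -> exists f : 'Hom(V, F^o), f x = 1.
Proof.
move=> xn0; have [i fi|f0] := pickP (fun i => vcoord i x != 0).
  by exists ((vcoord i x)^-1 *: vcoord i); rewrite lfunE; apply: mulVf.
case/eqP: xn0; rewrite (vcoord_sum x) big1 // => i _.
by move/negbFE/eqP: (f0 i) => ->; rewrite scale0r.
Qed.

Lemma exists_linear_ext (W : vectType F) (b : 'I_(\dim {:V}) -> W) :
  exists T : 'Hom(V, W), forall x, T x = \sum_i vcoord i x *: b i.
Proof.
pose g x := \sum_i vcoord i x *: b i.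
have lin : linear g.
  move=> a x y; rewrite /g scaler_sumr -big_split; apply: eq_bigr => i _ /=.
  by rewrite linearP scalerDl scalerA.
pose T := GRing.isLinear.Build F V W *:%R g lin.
pose T' : {linear V -> W} := HB.pack g T.
by exists (linfun T') => x; rewrite lfunE.
Qed.

Lemma Sn_invariantsP n (rho : 'M[F]_n -> 'End(V)) x :
  reflect (forall s : 'S_n, rho (perm_mx s) x = x) (x \in Sn_invariants rho).
Proof.
rewrite memvE; apply: (iffP subv_bigcapP) => [H s|H s _].
  by apply/fixedSpaceP; rewrite memvE H.
by rewrite -memvE; apply/fixedSpaceP.
Qed.

End Vectors.

Lemma dim_le_of_inj (F : fieldType) (V W : vectType F) (T : 'Hom(V, W))
    (U : {vspace V}) (U' : {vspace W}) :
  (forall x, x \in U -> T x \in U') ->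
  (forall x, x \in U -> T x = 0 -> x = 0) -> (\dim U <= \dim U')%N.
Proof.
move=> TU Tinj; rewrite -(@limg_dim_eq _ _ _ T).
  by apply: dimvS; apply/subvP => _ /memv_imgP[x /TU + ->].
apply/vspaceP => x; rewrite memv_cap memv_ker memv0.
apply/idP/eqP => [/andP[/Tinj + /eqP]|->]; first exact.
by rewrite mem0v linear0 eqxx.
Qed.

(** The linear relation [R] need not be single-valued. Partners chosen for the projections to [U] of
    a basis of [V] extend to a linear [T] with [R x (T x)] on [U], and the hypothesis on [R x 0]
    makes [T] injective there. *)
Lemma dim_le_of_relation (F : fieldType) (V W : vectType F) (R : V -> W -> Prop)
    (U : {vspace V}) (U' : {vspace W}) :
  R 0 0 ->
  (forall a x y x' y', R x y -> R x' y' -> R (a *: x + x') (a *: y + y')) ->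
  (forall x, x \in U -> exists2 y, y \in U' & R x y) ->
  (forall x, R x 0 -> x = 0) -> (\dim U <= \dim U')%N.
Proof.
move=> R0 RD RU Rinj.
have /fin_all_exists2[b bU Rb] : forall i : 'I_(\dim {:V}),
    exists2 y, y \in U' & R (projv U (vbasis {:V})`_i) y.
  by move=> i; apply: RU; apply: memv_proj.
have [T ET] := exists_linear_ext b.
apply: (@dim_le_of_inj _ _ _ T) => [x _|x xU Tx0].
  by rewrite ET; apply: memv_suml => i _; apply: memvZ.
apply: Rinj; rewrite -{}Tx0 ET.
rewrite -(projv_id xU) {1}(vcoord_sum x) linear_sum projv_id //=.
elim/big_ind2: _ => // [x1 y1 x2 y2 H1 H2|i _].
  by rewrite -[x1]scale1r -[y1]scale1r; apply: RD.
rewrite linearZ -[X in R X _]addr0 -[X in R _ X]addr0; apply: RD => //; exact: Rb.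
Qed.

(** * Extension to the monoid of matrices *)

Section MonoidRepr.
Variable F : numFieldType.

Definition eval_mx n (s : F) (G : 'M[{poly F}]_n) : 'M[F]_n := map_mx (horner_eval s) G.

(* A polynomial representation of the monoid of all matrices, possibly not
   unital; polynomiality is only recorded along polynomial curves of matrices. *)
Record monoid_repr n (V : vectType F) (rho : 'M[F]_n -> 'End(V)) : Prop := MonoidRepr {
  monoid_reprM : forall g h x, rho (g *m h) x = rho g (rho h x);
  monoid_repr_poly : forall (G : 'M[{poly F}]_n) (f : 'Hom(V, F^o)) x,
    polyfun 0 (fun s => f (rho (eval_mx s G) x)) }.

Lemma eval_mxM n s (G H : 'M[{poly F}]_n) : eval_mx s (G *m H) = eval_mx s G *m eval_mx s H.
Proof. exact: map_mxM. Qed.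

Lemma det_eval_mx n s (G : 'M[{poly F}]_n) : \det (eval_mx s G) = (\det G).[s].
Proof. by rewrite det_map_mx. Qed.

(** The line through the identity at [s = 0] and [g] at [s = 1]. Its determinant is a nonzero
    polynomial even when [g] is singular, so identities between invertible matrices pass to [g]. *)
Definition curve n (g : 'M[F]_n) : 'M[{poly F}]_n :=
  \matrix_(i, j) ((1 - 'X) * ((i == j)%:R)%:P + 'X * (g i j)%:P).

Lemma eval_curve n (g : 'M[F]_n) s : eval_mx s (curve g) = (1 - s) *: 1%:M + s *: g.
Proof. by apply/matrixP => i j; rewrite !mxE /horner_eval !hornerE. Qed.

Lemma eval_curve0 n (g : 'M[F]_n) : eval_mx 0 (curve g) = 1%:M.
Proof. by rewrite eval_curve subr0 scale1r scale0r addr0. Qed.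

Lemma eval_curve1 n (g : 'M[F]_n) : eval_mx 1 (curve g) = g.
Proof. by rewrite eval_curve subrr scale1r scale0r add0r. Qed.

Lemma det_neq0_of_eval0 n (G : 'M[{poly F}]_n) : eval_mx 0 G = 1%:M -> \det G != 0.
Proof.
move=> G0; apply: contra_eqN (congr1 (fun A => \det A) G0) => /eqP dG.
by rewrite det_eval_mx dG horner0 det1 eq_sym oner_eq0.
Qed.

Lemma polyfun_repr k (V : vectType F) (rho : F -> 'End(V)) (y : F -> V) l
    (f : 'Hom(V, F^o)) :
  (forall x, polyfun k (fun s => f (rho s x))) ->
  (forall f : 'Hom(V, F^o), polyfun l (fun s => f (y s))) ->
  polyfun (l + k) (fun s => f (rho s (y s))).
Proof.
move=> Hr Hy.
apply: (@eq_polyfun _ _ (fun s => \sum_i vcoord i (y s) * f (rho s (vbasis {:V})`_i))).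
  move=> s; rewrite {2}(vcoord_sum (y s)) !linear_sum; apply: eq_bigr => i _.
  by rewrite !linearZ.
by apply: polyfun_sum => i; apply: polyfunM.
Qed.

Lemma eval_mx_polyfun n (p : {mpoly F[n * n]}) (G : 'M[{poly F}]_n) :
  polyfun 0 (fun s => p.@[fun k => mxvec (eval_mx s G) 0 k]).
Proof.
exists (mmap polyC (fun k => mxvec G 0 k) p) => s.
rewrite mul1r mevalE /mmap horner_sum; apply: eq_bigr => mu _.
rewrite hornerM hornerC; congr (_ * _).
rewrite /mmap1 horner_prod; apply: eq_bigr => k _.
rewrite horner_exp; congr (_ ^+ _).
by rewrite /eval_mx -map_mxvec mxE.
Qed.

(** The polynomials giving the matrix entries of [rho] in a basis define [rho'] on all matrices.
    Multiplicativity holds wherever [curve g] and [curve h] are both invertible, hence at every [s],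
    in particular at [s = 1]. *)
Lemma GL_repr_extension n (V : vectType F) (rho : 'M[F]_n -> 'End(V)) :
  GL_repr rho -> GL_polynomial rho ->
  exists2 rho' : 'M[F]_n -> 'End(V), monoid_repr rho' & {in unitmx, rho' =1 rho}.
Proof.
move=> [rho1 rhoM] rho_poly; set b := vbasis {:V}.
have /fin_all_exists[p Hp] : forall ij : 'I_(\dim {:V}) * 'I_(\dim {:V}),
  exists p : {mpoly F[n * n]}, {in unitmx, forall g : 'M[F]_n,
    vcoord ij.1 (rho g b`_ij.2) = p.@[fun k => mxvec g 0 k]}.
  by move=> [i j]; apply: rho_poly.
pose w g j := \sum_i (p (i, j)).@[fun k => mxvec g 0 k] *: b`_i.
have [rho' Hrho'] : exists rho' : 'M[F]_n -> 'End(V),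
    forall g x, rho' g x = \sum_j vcoord j x *: w g j.
  by have [T ET] := boolp.choice (fun g => exists_linear_ext (w g)); exists T.
have E : {in unitmx, rho' =1 rho}.
  move=> g gU; apply/lfunP => x; rewrite Hrho' {2}(vcoord_sum x) linear_sum.
  apply: eq_bigr => j _; rewrite linearZ; congr (_ *: _).
  by rewrite [RHS]vcoord_sum; apply: eq_bigr => i _; rewrite (Hp (i, j)).
have P : forall (G : 'M[{poly F}]_n) (f : 'Hom(V, F^o)) x,
    polyfun 0 (fun s => f (rho' (eval_mx s G) x)).
  move=> G f x.
  apply: (@eq_polyfun _ _ (fun s => \sum_j \sum_(i < \dim {:V}) (vcoord j x * f b`_i) *
    (p (i, j)).@[fun k => mxvec (eval_mx s G) 0 k])).
    move=> s; rewrite Hrho' linear_sum; apply: eq_bigr => j _.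
    rewrite linearZ linear_sum /= scaler_sumr; apply: eq_bigr => i _.
    by rewrite linearZ -mulrA; congr (_ * _); apply: mulrC.
  apply: polyfun_sum => j; apply: polyfun_sum => i.
  apply: (@polyfunM _ 0 0); last exact: eval_mx_polyfun.
  by exists (vcoord j x * f b`_i)%:P => s; rewrite hornerC mul1r.
exists rho' => //; split => // g h x.
apply: functional_eq => f.
have := @polyfun_generic_eq _ (\det (curve g) * \det (curve h))
  (fun s => f (rho' (eval_mx s (curve g *m curve h)) x))
  (fun s => f (rho' (eval_mx s (curve g)) (rho' (eval_mx s (curve h)) x))).
move/(_ (P _ _ _)); rewrite mulf_neq0 ?det_neq0_of_eval0 ?eval_curve0 //.
have Q : polyfun 0 (fun s => f (rho' (eval_mx s (curve g)) (rho' (eval_mx s (curve h)) x))).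
  by apply: (@polyfun_repr 0 _ _ _ 0) => // z; apply: P.
move/(_ Q isT) => /(_ _ 1); rewrite eval_mxM !eval_curve1; apply => s.
rewrite hornerM -!det_eval_mx mulf_eq0 negb_or => /andP[gU hU].
rewrite eval_mxM !E ?unitmx_mul ?unitmxE ?unitfE ?gU ?hU // rhoM ?comp_lfunE //;
  by rewrite unitmxE unitfE.
Qed.

End MonoidRepr.

(** * Matrix coefficients of highest weight vectors *)

Section HighestWeight.
Variable F : numFieldType.

Definition is_LDU n (A : 'M[F]_n) := exists L (t : 'rV[F]_n) U,
  [/\ upper_unipotent L^T, forall i, t 0 i != 0, upper_unipotent U
    & A = L *m diag_mx t *m U].

Lemma upper_unipotent1 n : upper_unipotent (1%:M : 'M[F]_n).
Proof. by move=> i j _; rewrite mxE. Qed.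

Lemma upper_unipotent_block m k (A : 'M[F]_m) B (D : 'M[F]_k) :
  upper_unipotent A -> upper_unipotent D -> upper_unipotent (block_mx A B 0 D).
Proof.
move=> uA uD i j.
case: (split_ordP i) => i' ->; case: (split_ordP j) => j' -> le;
  rewrite ?(block_mxEul, block_mxEur, block_mxEdl, block_mxEdr).
- by rewrite uA // (inj_eq (@lshift_inj _ _)).
- by move: le; rewrite /= leqNgt (leq_trans (ltn_ord i')) ?leq_addr.
- by rewrite mxE eq_rlshift.
- by rewrite uD ?(inj_eq (@rshift_inj _ _)) //; move: le; rewrite leq_add2l.
Qed.

(** One step of Gaussian elimination. The Schur complement is multiplied by the pivot [a], so that
    it stays polynomial for polynomial matrices; the torus part absorbs the factor. *)
Lemma LDU_Schur n (a : F) (b : 'rV_n) (c : 'cV_n) (d : 'M[F]_n) :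
  a != 0 -> is_LDU (a *: d - c *m b) -> is_LDU (block_mx a%:M b c d : 'M_(1 + n)).
Proof.
move=> an0 [L [t [U [lL tn0 uU E]]]].
have dE : d = a^-1 *: (c *m b) + a^-1 *: (L *m diag_mx t *m U).
  by rewrite -E -scalerDr addrC subrK scalerK.
exists (block_mx 1%:M 0 (a^-1 *: c) L), (row_mx a%:M (a^-1 *: t)),
  (block_mx 1%:M (a^-1 *: b) 0 U); split.
- rewrite tr_block_mx trmx0 trmx1; apply: upper_unipotent_block => //.
  exact: upper_unipotent1.
- move=> i; case: (split_ordP i) => j ->; rewrite ?row_mxEl ?row_mxEr !mxE.
    by rewrite !ord1 eqxx.
  by rewrite mulf_neq0 ?invr_eq0.
- exact: upper_unipotent_block (@upper_unipotent1 1) uU.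
rewrite diag_mx_row !mulmx_block !(mul1mx, mulmx0, mul0mx, mulmx1, addr0, add0r).
have -> : diag_mx a%:M = (a%:M : 'M_1).
  by apply/matrixP => i j; rewrite !mxE !ord1.
rewrite !mul_scalar_mx !mul_mx_scalar !scalerA mulfV // !scale1r.
rewrite {1}dE -[in RHS]mulmxA -[c *m (_ *: _)]scalemxAr [diag_mx (_ *: _)]linearZ.
by rewrite -!mulmxA -scalemxAl -scalemxAr.
Qed.

(** Here [q] is the product of the pivots of the fraction-free elimination. Each of them is 1 at
    [s = 0], hence a nonzero polynomial. *)
Lemma LDU_generic n (G : 'M[{poly F}]_n) : eval_mx 0 G = 1%:M ->
  exists2 q : {poly F}, q != 0 & forall s, q.[s] != 0 -> is_LDU (eval_mx s G).
Proof.
elim: n G => [|n IH] G G0.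
  exists 1; first exact: oner_neq0.
  by move=> s _; exists 0, 0, 0; split; try case; rewrite // flatmx0 [RHS]flatmx0.
pose H : 'M_(1 + n) := G.
pose a := H 0 0; pose b := ursubmx H; pose c := dlsubmx H; pose d := drsubmx H.
have EH s : eval_mx s G =
    block_mx (a.[s]%:M) (map_mx (horner_eval s) b) (map_mx (horner_eval s) c) (eval_mx s d).
  have <- : map_mx (horner_eval s) (a%:M : 'M_1) = a.[s]%:M by rewrite map_scalar_mx.
  rewrite -map_block_mx; congr map_mx.
  rewrite -/H -[LHS]submxK -/b -/c -/d; congr (block_mx _ b c d).
  apply/matrixP => i j; rewrite !mxE !ord1 eqxx mulr1n.
  by congr (G _ _); apply: val_inj.
have [a0 d0] : a.[0] = 1 /\ eval_mx 0 d = 1%:M /\ map_mx (horner_eval 0) b = 0.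
  have /eq_block_mx[] : block_mx (a.[0]%:M) (map_mx (horner_eval 0) b)
      (map_mx (horner_eval 0) c) (eval_mx 0 d) = block_mx (1%:M : 'M_1) 0 0 (1%:M : 'M_n).
    by rewrite -EH G0 (@scalar_mx_block _ 1 n).
  move=> /matrixP/(_ 0 0) + -> _ ->; rewrite !mxE !eqxx !mulr1n => ->.
  by [].
case: d0 => d0 b0.
have ES s : eval_mx s (a *: d - c *m b) =
    a.[s] *: eval_mx s d - map_mx (horner_eval s) c *m map_mx (horner_eval s) b.
  by rewrite /eval_mx map_mxD map_mxN map_mxM map_mxZ.
have [|q qn0 Hq] := IH (a *: d - c *m b).
  by rewrite ES a0 d0 b0 mulmx0 subr0 scale1r.
exists (a * q).
  rewrite mulf_neq0 //; apply: contra_eq_neq a0 => ->.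
  by rewrite horner0 eq_sym oner_eq0.
move=> s; rewrite hornerM mulf_eq0 negb_or => /andP[as0 /Hq]; rewrite ES EH.
exact: LDU_Schur.
Qed.

Section Functional.
Variables (n : nat) (lam : seq nat).
Implicit Types V : vectType F.

Definition hw_vector V (rho : 'M[F]_n -> 'End(V)) v := [/\ v != 0,
  weight_vector rho lam v & forall u, upper_unipotent u -> rho u v = v].

Definition hw (t : 'rV[F]_n) := \prod_(i < n) t 0 i ^+ nth 0%N lam i.

(* Apply the torus curve T(s) = diag(s^i): it contracts lower unipotent
   matrices to 1 as s -> 0, so the coefficient of s^N, where N is the exponent
   of hw(T(s)), extracts the highest weight component. *)
Lemma hw_functional V (rho : 'M[F]_n -> 'End(V)) v :
  monoid_repr rho -> hw_vector rho v ->
  exists f : 'Hom(V, F^o), forall (L : 'M_n) (t : 'rV_n) (U : 'M_n),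
    upper_unipotent L^T -> (forall i, t 0 i != 0) -> upper_unipotent U ->
    f (rho (L *m diag_mx t *m U) v) = hw t.
Proof.
move=> [rhoM rhoP] [vn0 wv uv].
have [f0 f0v] := exists_functional vn0.
pose T : 'M[{poly F}]_n := diag_mx (\row_i 'X^i).
have ET s : eval_mx s T = diag_mx (\row_i s ^+ i).
  rewrite /eval_mx map_diag_mx; congr diag_mx; apply/rowP => i.
  by rewrite !mxE; apply: hornerXn.
pose N := (\sum_(i < n) i * nth 0%N lam i)%N.
have hwT s : hw (\row_i s ^+ i) = s ^+ N.
  by rewrite /hw /N expr_sum; apply: eq_bigr => i _; rewrite mxE exprM.
have /fin_all_exists[q Hq] : forall j : 'I_(\dim {:V}), exists q : {poly F},
    forall s, f0 (rho (eval_mx s T) (vbasis {:V})`_j) = q.[s].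
  by move=> j; have [q Hq] := rhoP T f0 (vbasis {:V})`_j; exists q => s; rewrite Hq mul1r.
have [f Hf] := @exists_linear_ext _ V F^o (fun j => (q j)`_N).
pose Q x := \sum_j (vcoord j x : F) *: q j.
have HQ x s : f0 (rho (eval_mx s T) x) = (Q x).[s].
  rewrite {1}(vcoord_sum x) !linear_sum horner_sum; apply: eq_bigr => j _.
  by rewrite !linearZ hornerZ -Hq.
have fQ x : f x = (Q x)`_N.
  by rewrite Hf coef_sum; apply: eq_bigr => j _; rewrite coefZ.
exists f => L t U lL tn0 uU.
rewrite !rhoM uv // wv // -/(hw t) !linearZ /= fQ.
suff -> : (Q (rho L v))`_N = 1 by apply: mulr1.
(* For nonzero [s] this is the conjugate of [L] by [T(s)]. Truncated subtraction in the exponent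
   only matters above the diagonal, where [L] vanishes. *)
pose K : 'M[{poly F}]_n := \matrix_(i, j) ('X^(i - j) * (L i j)%:P).
have EK s : eval_mx s T *m L = eval_mx s K *m eval_mx s T.
  rewrite ET mul_diag_mx mul_mx_diag; apply/matrixP => i j; rewrite !mxE.
  rewrite /horner_eval !hornerE.
  have [le|gt] := leqP j i; first by rewrite mulrAC -exprD subnK.
  have := lL j i (ltnW gt); rewrite mxE -val_eqE gtn_eqF // => ->.
  by rewrite !(mulr0, mul0r).
have K0 : eval_mx 0 K = 1%:M.
  apply/matrixP => i j; rewrite !mxE /horner_eval !hornerE expr0n subn_eq0.
  have [le|gt] := leqP i j; last by rewrite mul0r -val_eqE gtn_eqF.
  by have := lL j i le; rewrite mxE mul1r eq_sym.
have [r Hr] := rhoP K f0 v.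
suff -> : Q (rho L v) = 'X^N * r.
  rewrite coefXnM ltnn subnn -horner_coef0.
  by have := Hr 0; rewrite mul1r K0 uv ?f0v //; apply: upper_unipotent1.
apply: (@horner_generic_eq _ 'X); rewrite ?polyX_eq0 // => s; rewrite hornerX => sn0.
rewrite -HQ -rhoM EK rhoM ET wv => [|i]; last by rewrite mxE expf_neq0.
by rewrite -/(hw _) hwT !linearZ /= Hr mul1r hornerM hornerXn.
Qed.

Lemma hw_functional1 V (rho : 'M[F]_n -> 'End(V)) v (f : 'Hom(V, F^o)) :
  hw_vector rho v ->
  (forall (L : 'M_n) (t : 'rV_n) (U : 'M_n),
    upper_unipotent L^T -> (forall i, t 0 i != 0) -> upper_unipotent U ->
    f (rho (L *m diag_mx t *m U) v) = hw t) -> f v = 1.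
Proof.
move=> [_ _ uv] Hf; have := Hf 1%:M (const_mx 1) 1%:M.
rewrite trmx1 mulmx1 mul1mx diag_const_mx uv; last exact: upper_unipotent1.
rewrite /hw big1 => [|i _]; last by rewrite mxE expr1n.
by apply=> [|i|]; rewrite ?mxE ?oner_eq0 //; apply: upper_unipotent1.
Qed.

(** On LDU products both coefficients equal [hw lam t]. Such products are generic on the curve from
    the identity to [A], so the coefficients agree at [A]. *)
Lemma hw_matrix_coef V (W : vectType F) (rho : 'M[F]_n -> 'End(V))
    (tau : 'M[F]_n -> 'End(W)) v w :
  monoid_repr rho -> monoid_repr tau -> hw_vector rho v -> hw_vector tau w ->
  exists (f : 'Hom(V, F^o)) (g : 'Hom(W, F^o)),
    [/\ f v = 1, g w = 1 & forall A, f (rho A v) = g (tau A w)].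
Proof.
move=> Hrho Htau hv hw_.
have [f Hf] := hw_functional Hrho hv; have [g Hg] := hw_functional Htau hw_.
exists f, g; split; [exact: hw_functional1 hv Hf|exact: hw_functional1 hw_ Hg|].
move=> A; have [q qn0 Hq] := LDU_generic (eval_curve0 A).
rewrite -(eval_curve1 A).
apply: (polyfun_generic_eq (monoid_repr_poly Hrho (curve A) f v)
  (monoid_repr_poly Htau (curve A) g w) qn0) => s /Hq[L [t [U [lL tn0 uU ->]]]].
by rewrite Hf ?Hg.
Qed.

End Functional.
End HighestWeight.

(** * Uniqueness of the irreducible representation *)

Section Cyclic.
Variable F : numFieldType.

Section FormalSums.
Variables (n : nat) (V : vectType F) (rho : 'M[F]_n -> 'End(V)).

(** A list of weighted matrices stands for an element of the monoid algebra. The same list acts on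
    every representation, which allows two of them to be compared. *)
Definition formal_act (z : seq (F * 'M[F]_n)) (x : V) : V :=
  \sum_(cg <- z) cg.1 *: rho cg.2 x.

Definition formal_scale n (a : F) (z : seq (F * 'M[F]_n)) := [seq (a * cg.1, cg.2) | cg <- z].

Definition formal_mul n (z z' : seq (F * 'M[F]_n)) :=
  [seq (cg.1 * dh.1, cg.2 *m dh.2) | cg <- z, dh <- z'].

Lemma formal_act_linear a z z' x :
  formal_act (formal_scale a z ++ z') x = a *: formal_act z x + formal_act z' x.
Proof.
rewrite /formal_act big_cat big_map scaler_sumr; congr (_ + _).
by apply: eq_bigr => cg _; rewrite scalerA.
Qed.

Lemma linear_formal_act (f : 'Hom(V, F^o)) z x :
  f (formal_act z x) = \sum_(cg <- z) cg.1 *: f (rho cg.2 x).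
Proof. by rewrite linear_sum; apply: eq_bigr => cg _; rewrite linearZ. Qed.

Hypothesis Hrho : monoid_repr rho.

Lemma formal_act_mul z z' x :
  formal_act (formal_mul z z') x = formal_act z (formal_act z' x).
Proof.
rewrite /formal_act big_allpairs_dep; apply: eq_bigr => cg _.
rewrite linear_sum scaler_sumr; apply: eq_bigr => dh _ /=.
by rewrite (monoid_reprM Hrho) linearZ scalerA.
Qed.

Lemma formal_act_repr A z x : formal_act (formal_mul [:: (1, A)] z) x = rho A (formal_act z x).
Proof. by rewrite formal_act_mul /formal_act big_seq1 scale1r. Qed.

End FormalSums.

(* Irreducibility of the restriction of rho to the image of the idempotent rho 1. *)
Definition cyclic_repr n (V : vectType F) (rho : 'M[F]_n -> 'End(V)) := forall x y,
  rho 1%:M x = x -> x != 0 -> rho 1%:M y = y -> exists z, formal_act rho z x = y.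

(** The vectors obtained from [x] by formal sums form a stable subspace containing [x]. *)
Lemma irreducible_cyclic n (V : vectType F) (rho rho' : 'M[F]_n -> 'End(V)) :
  GL_irreducible rho -> monoid_repr rho' -> {in unitmx, rho' =1 rho} -> cyclic_repr rho'.
Proof.
move=> [_ irr] Hrho' E x y x1 xn0 _.
have [||U HU] := @vspace_of_closed _ V (fun y => exists z, formal_act rho' z x = y).
- by exists [::]; rewrite /formal_act big_nil.
- move=> a _ _ [z <-] [z' <-]; exists (formal_scale a z ++ z').
  exact: formal_act_linear.
have st : GL_stable rho U.
  move=> g gU; apply/subvP => _ /memv_imgP[u /HU[z <-] ->]; apply/HU.
  by exists (formal_mul [:: (1, g)] z); rewrite formal_act_repr // E.
have xU : x \in U by apply/HU; exists [:: (1, 1%:M)]; rewrite /formal_act big_seq1 scale1r.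
have [U0|Uf] := irr U st; first by move: xU; rewrite U0 memv0 (negPf xn0).
by apply/HU; rewrite Uf memvf.
Qed.

Section Comparison.
Variables (n : nat) (lam : seq nat) (V W : vectType F).
Variables (rho : 'M[F]_n -> 'End(V)) (tau : 'M[F]_n -> 'End(W)) (v : V) (w : W).
Hypotheses (Hrho : monoid_repr rho) (Htau : monoid_repr tau).
Hypotheses (hv : hw_vector lam rho v) (hw_ : hw_vector lam tau w).
Hypothesis rho_cyc : cyclic_repr rho.

(** If [z v] were nonzero, cyclicity would give [z'] with [z' z v = v]. The common matrix
    coefficient would then be 1 on [v] and, since [z w = 0], also 0. Hence [z w] determines
    [z v]. *)
Lemma formal_act_eq0 z : formal_act tau z w = 0 -> formal_act rho z v = 0.
Proof.
move=> zw; apply/eqP; apply: contraT => zv.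
have v1 : rho 1%:M v = v by case: hv => _ _; apply; apply: upper_unipotent1.
have zv1 : rho 1%:M (formal_act rho z v) = formal_act rho z v.
  rewrite linear_sum; apply: eq_bigr => cg _ /=.
  by rewrite linearZ /= -(monoid_reprM Hrho) mul1mx.
have [z' Hz'] := rho_cyc zv1 zv v1.
have [f [g [fv _ fg]]] := hw_matrix_coef Hrho Htau hv hw_.
have : f (formal_act rho (formal_mul z' z) v) = g (formal_act tau (formal_mul z' z) w).
  by rewrite !linear_formal_act; apply: eq_bigr => cg _; rewrite fg.
rewrite !formal_act_mul // Hz' zw fv /formal_act big1 ?linear0 => [/eqP|cg _].
  by rewrite oner_eq0.
by rewrite linear0 scaler0.
Qed.

End Comparison.

(** The relation between [z v] and [z w] is the graph of an equivariant isomorphism between the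
    images of the identity matrix. A partner of an invariant vector is invariant because 0 is
    related only to 0. *)
Lemma dim_Sn_invariants_le n (lam : seq nat) (V W : vectType F)
    (rho : 'M[F]_n -> 'End(V)) (tau : 'M[F]_n -> 'End(W)) v w :
  monoid_repr rho -> monoid_repr tau -> hw_vector lam rho v -> hw_vector lam tau w ->
  cyclic_repr rho -> cyclic_repr tau ->
  (\dim (Sn_invariants rho) <= \dim (Sn_invariants tau))%N.
Proof.
move=> Hrho Htau hv hw_ rho_cyc tau_cyc.
pose R x y := exists2 z, formal_act rho z v = x & formal_act tau z w = y.
have RD a x y x' y' : R x y -> R x' y' -> R (a *: x + x') (a *: y + y').
  move=> [z <- <-] [z' <- <-]; exists (formal_scale a z ++ z'); exact: formal_act_linear.
have R0 y : R 0 y -> y = 0.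
  by move=> [z zv <-]; apply: (formal_act_eq0 Htau Hrho hw_ hv) zv.
have v1 : rho 1%:M v = v by case: hv => _ _; apply; apply: upper_unipotent1.
apply: (@dim_le_of_relation _ _ _ R) => // [|x /Sn_invariantsP xinv|x].
- by exists [::]; rewrite /formal_act big_nil.
(* [rho] need not be unital; invariance under the trivial permutation places [x] in the image of
   [rho 1%:M]. *)
- have x1 : rho 1%:M x = x by rewrite -(perm_mx1 _ n) xinv.
  have [z Hz] : exists z, formal_act rho z v = x by apply: rho_cyc => //; case: hv.
  exists (formal_act tau z w); last by exists z.
  apply/Sn_invariantsP => s; apply/eqP; rewrite -subr_eq0; apply/eqP; apply: R0.
  have -> : 0 = -1 *: x + rho (perm_mx s) x by rewrite xinv scaleN1r addNr.
  rewrite [X in R _ X]addrC -[X in R _ (X + _)]scaleN1r; apply: RD; first by exists z.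
  by exists (formal_mul [:: (1, perm_mx s)] z); rewrite formal_act_repr // Hz.
by move=> [z <- zw]; apply: (formal_act_eq0 Hrho Htau hv hw_) zw.
Qed.

End Cyclic.

(** * Truncation to the first m coordinates *)

Section Corner.
Variables (F : numFieldType) (m k : nat) (W : vectType F).
Variable sigma : 'M[F]_(m + k) -> 'End(W).
Hypothesis Hsigma : monoid_repr sigma.

Definition corner (R : nzRingType) (A : 'M[R]_m) : 'M[R]_(m + k) := block_mx A 0 0 0.

Lemma cornerM (A B : 'M[F]_m) : corner (A *m B) = corner A *m corner B.
Proof. by rewrite mulmx_block !(mulmx0, mul0mx, addr0). Qed.

Lemma corner1_mul (A : 'M[F]_m) (B : 'M[F]_k) : corner 1%:M *m block_mx A 0 0 B = corner A.
Proof. by rewrite mulmx_block !(mulmx0, mul0mx, addr0, mul1mx). Qed.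

Lemma mul_corner1 (A : 'M[F]_m) (B : 'M[F]_k) : block_mx A 0 0 B *m corner 1%:M = corner A.
Proof. by rewrite mulmx_block !(mulmx0, mul0mx, addr0, mulmx1). Qed.

Lemma corner_compress (A : 'M[F]_(m + k)) :
  corner 1%:M *m A *m corner 1%:M = corner (ulsubmx A).
Proof.
by rewrite -{1}[A]submxK !mulmx_block !(mulmx0, mul0mx, mulmx1, mul1mx, addr0).
Qed.

Definition corner_repr (A : 'M[F]_m) : 'End(W) := sigma (corner A).

Lemma corner_monoid_repr : monoid_repr corner_repr.
Proof.
split=> [g h x|G f x]; first by rewrite /corner_repr cornerM (monoid_reprM Hsigma).
apply: eq_polyfun (monoid_repr_poly Hsigma (corner G) f x) => s.
by rewrite /eval_mx map_block_mx !map_mx0.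
Qed.

(** If [z x = y] with [x] and [y] in the image of the idempotent [E], then [E z E] also sends [x] to
    [y], and its matrices are corners. *)
Lemma corner_cyclic : cyclic_repr sigma -> sigma 1%:M = \1%VF -> cyclic_repr corner_repr.
Proof.
move=> cyc s1 x y x1 xn0 y1.
have [||z Hz] := cyc x y _ xn0; rewrite ?s1 ?lfunE //.
exists [seq (cg.1, ulsubmx cg.2) | cg <- z].
rewrite -y1 -Hz linear_sum /formal_act big_map; apply: eq_bigr => cg _ /=.
rewrite linearZ; congr (_ *: _).
by rewrite /corner_repr -corner_compress !(monoid_reprM Hsigma) -/(corner_repr _) x1.
Qed.

(** The main point is that [corner k 1%:M] fixes [w]. As [lam] has at most [m] entries,
    [diag(1_m, s)] fixes [w] for nonzero [s], hence also for [s = 0] by polynomiality. *)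
Lemma corner_hw_vector (lam : seq nat) w : (size lam <= m)%N ->
  hw_vector lam sigma w -> hw_vector lam corner_repr w.
Proof.
move=> lam_m [wn0 ww uw].
have weight (t : 'rV_m) (s : F) : (forall i, t 0 i != 0) -> s != 0 ->
    sigma (block_mx (diag_mx t) 0 0 s%:M) w = (\prod_(i < m) t 0 i ^+ nth 0%N lam i) *: w.
  move=> tn0 sn0; rewrite -diag_const_mx -diag_mx_row ww => [|i].
    rewrite big_split_ord /= [X in _ * X]big1 => [|i _].
      by rewrite mulr1; congr (_ *: _); apply: eq_bigr => i _; rewrite row_mxEl.
    by rewrite nth_default ?expr0 // (leq_trans lam_m) ?leq_addr.
  by case: (split_ordP i) => j ->; rewrite ?row_mxEl ?row_mxEr // mxE.
have w1 : sigma (corner 1%:M) w = w.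
  apply: functional_eq => f; pose G : 'M[{poly F}]_(m + k) := block_mx 1%:M 0 0 'X%:M.
  have EG s : eval_mx s G = block_mx 1%:M 0 0 s%:M.
    by rewrite /eval_mx map_block_mx !map_mx0 map_mx1 map_scalar_mx /= /horner_eval hornerX.
  have fw : polyfun 0 (fun=> f w) by exists (f w)%:P => s; rewrite hornerC mul1r.
  have := polyfun_generic_eq (monoid_repr_poly Hsigma G f w) fw (negbT (polyX_eq0 _)).
  move=> /(_ _ 0); rewrite EG raddf0; apply => s; rewrite hornerX EG => sn0.
  rewrite -diag_const_mx weight ?big1 ?scale1r // => i; rewrite mxE ?oner_neq0 //.
  by rewrite expr1n.
split=> // [t tn0|u uu].
  rewrite /corner_repr -(mul_corner1 _ 1%:M) (monoid_reprM Hsigma) w1.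
  by rewrite weight // oner_neq0.
rewrite /corner_repr -(mul_corner1 _ 1%:M) (monoid_reprM Hsigma) w1 uw //.
by apply: upper_unipotent_block => //; apply: upper_unipotent1.
Qed.

End Corner.

(** * Supports of weights *)

(** Once [s] agrees with [f] away from [a], composing with the transposition of [s a] and [f a]
    corrects the value at [a]; injectivity keeps the other values on [A] unmoved. *)
Lemma perm_extension (T : finType) (A : {set T}) (f : T -> T) :
  {in A &, injective f} -> exists s : {perm T}, {in A, s =1 f}.
Proof.
move cA: #|A| => c; elim: c A cA => [|c IH] A cA finj.
  by exists 1%g => x; rewrite (cards0_eq cA) inE.
have [a aA] : exists a, a \in A by apply/card_gt0P; rewrite cA.
have [||s Hs] := IH (A :\ a).
- by apply/eqP; rewrite -eqSS -cA (cardsD1 a A) aA.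
- by move=> x y /setD1P[_ xA] /setD1P[_ yA]; apply: finj.
exists (s * tperm (s a) (f a))%g => x xA; rewrite permM.
have [->|xa] := eqVneq x a; first by rewrite tpermL.
have xAa : x \in A :\ a by rewrite !inE xa.
rewrite tpermD; first exact: Hs.
  by rewrite (inj_eq perm_inj) eq_sym.
by rewrite Hs // eq_sym; apply: contra_neq xa => E; apply: finj.
Qed.

Lemma perm_into (n m : nat) (A : {set 'I_n}) (le_mn : (m <= n)%N) : (#|A| <= m)%N ->
  exists s : 'S_n, {in A, forall i, s i < m}%N.
Proof.
move=> Am.
have lt i : i \in A -> (index i (enum A) < m)%N.
  by move=> iA; apply: leq_trans Am; rewrite cardE index_mem mem_enum.
(* On [A] the index is below [n], so the default of [insubd] is never returned there. *)
have [|s Hs] := @perm_extension _ A (fun i => insubd i (index i (enum A))).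
  move=> i j iA jA /(congr1 val); rewrite !val_insubd !(leq_trans (lt _ _) le_mn) //.
  by move/(congr1 (nth i (enum A))); rewrite !nth_index ?mem_enum.
by exists s => i iA; rewrite Hs // val_insubd (leq_trans (lt _ _)) ?lt.
Qed.

(** * Idempotents of coordinate sets and homogeneity *)

Section SetIdempotents.
Variables (F : numFieldType) (n : nat).

Definition setmx (A : {set 'I_n}) : 'M[F]_n := diag_mx (\row_i (i \in A)%:R).

Lemma setmxI A B : setmx A *m setmx B = setmx (A :&: B).
Proof.
by rewrite mulmx_diag; congr diag_mx; apply/rowP => i; rewrite !mxE inE -natrM mulnb.
Qed.

Lemma setmxT : setmx setT = 1%:M.
Proof. by rewrite -diag_const_mx; congr diag_mx; apply/rowP => i; rewrite !mxE inE. Qed.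

Lemma setmx_perm (s : 'S_n) A : setmx A *m perm_mx s = perm_mx s *m setmx (s @: A).
Proof.
rewrite mul_diag_mx mul_mx_diag; apply/matrixP => i j; rewrite !mxE.
have [<-|] := eqVneq (s i) j; last by rewrite mulr0 mul0r.
by rewrite mulr1 mul1r mem_imset //; apply: perm_inj.
Qed.

(** The ring is arbitrary so that [dilation A 'X] is the polynomial curve of torus elements with
    values [dilation A s]. *)
Definition dilation (R : nzRingType) (A : {set 'I_n}) (s : R) : 'M[R]_n :=
  diag_mx (\row_i if i \in A then s else 1).

Lemma eval_dilation A (s : F) : eval_mx s (dilation A 'X) = dilation A s.
Proof.
rewrite /eval_mx map_diag_mx; congr diag_mx; apply/rowP => i; rewrite !mxE.
by case: ifP => _; [apply: hornerX|apply: hornerC].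
Qed.

Lemma dilation0 i : dilation [set i] (0 : F) = setmx (~: [set i]).
Proof. by congr diag_mx; apply/rowP => j; rewrite !mxE !inE; case: eqP. Qed.

Lemma dilationD1 (A : {set 'I_n}) i (s : F) : i \in A ->
  dilation A s = dilation [set i] s *m dilation (A :\ i) s.
Proof.
move=> iA; rewrite mulmx_diag; congr diag_mx; apply/rowP => j; rewrite !mxE !inE.
by have [->|] := eqVneq j i; rewrite ?iA ?mulr1 ?mul1r.
Qed.

Lemma dilation_setmx A (s : F) : dilation A s *m setmx A = s%:M *m setmx A.
Proof.
rewrite -diag_const_mx !mulmx_diag; congr diag_mx; apply/rowP => j; rewrite !mxE.
by case: ifP; rewrite ?mulr0.
Qed.

Section Homogeneous.
Variables (V : vectType F) (sigma : 'M[F]_n -> 'End(V)).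
Hypothesis Hsigma : monoid_repr sigma.

(** Each [i] in [A] contributes a factor [s]: the dilation at [i] may be replaced by its difference
    with its value at [s = 0], since that value kills [x], and this difference is divisible by
    [s]. *)
Lemma dilation_vanishing (A : {set 'I_n}) x :
  {in A, forall i, sigma (setmx (~: [set i])) x = 0} ->
  forall f : 'Hom(V, F^o), polyfun #|A| (fun s => f (sigma (dilation A s) x)).
Proof.
move cA: #|A| => c; elim: c A x cA => [|c IH] A x cA x0 f.
  by apply: eq_polyfun (monoid_repr_poly Hsigma (dilation A 'X) f x) => s; rewrite eval_dilation.
have [i iA] : exists i, i \in A by apply/card_gt0P; rewrite cA.
pose rho s := sigma (dilation [set i] s) - sigma (dilation [set i] 0).
pose y s := sigma (dilation (A :\ i) s) x.
apply: (@eq_polyfun _ _ (fun s => f (rho s (y s)))) => [s|].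
  rewrite /rho add_lfunE opp_lfunE /y -!(monoid_reprM Hsigma) -dilationD1 //.
  by rewrite dilation0 diag_mxC (monoid_reprM Hsigma) x0 // linear0 subr0.
rewrite -addn1; apply: polyfun_repr => [z|g].
  apply: eq_polyfun (polyfun_diff (monoid_repr_poly Hsigma (dilation [set i] 'X) f z)) => s.
  by rewrite /rho add_lfunE opp_lfunE linearB !eval_dilation.
apply: IH => [|j /setD1P[_ jA]]; last exact: x0.
by apply/eqP; rewrite -eqSS -cA (cardsD1 i A) iA.
Qed.

(* The components of w of weight mu with support in A are seen by setmx A, and
   a weight occurring in degree d has support of size at most d. *)
Lemma homogeneous_eq0 d w : sigma 1%:M w = w ->
  (forall s x, s != 0 -> sigma s%:M x = s ^+ d *: x) ->
  (forall A : {set 'I_n}, (#|A| <= d)%N -> sigma (setmx A) w = 0) -> w = 0.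
Proof.
move=> w1 hom wA.
suff H A : sigma (setmx A) w = 0 by rewrite -w1 -setmxT H.
move cA: #|A| => c; elim/ltn_ind: c A cA => c IH A cA.
have [le|gt] := leqP c d; first by rewrite wA ?cA.
set x := sigma _ w; apply: functional_eq => f.
have [i iA|q Hq] := @dilation_vanishing A x _ f.
  rewrite -(monoid_reprM Hsigma) setmxI setIC -setDE.
  by apply: IH erefl; rewrite -cA [in X in (_ < X)%N](cardsD1 i) iA.
(* On the image of [setmx A] the dilation acts as the scalar matrix [s], thus by [s ^+ d].
   Divisibility by a power of [s] beyond [d] forces [f x = 0]. *)
have E : (f x : F) *: 'X^d = 'X^#|A| * q.
  apply: (@horner_generic_eq _ 'X); rewrite ?polyX_eq0 // => s; rewrite hornerX => sn0.
  rewrite hornerM !hornerE -Hq -(monoid_reprM Hsigma) dilation_setmx.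
  by rewrite (monoid_reprM Hsigma) hom // linearZ mulrC.
have := congr1 (fun p : {poly F} => p`_d) E.
by rewrite coefZ coefXn eqxx mulr1 coefXnM cA gt linear0.
Qed.

End Homogeneous.
End SetIdempotents.

(** * Stability of the invariants *)

Section Stabilization.
Variables (F : numFieldType) (m k : nat) (V : vectType F).
Variable sigma : 'M[F]_(m + k) -> 'End(V).
Hypotheses (Hsigma : monoid_repr sigma) (sigma1 : sigma 1%:M = \1%VF).

Let M : {set 'I_(m + k)} := [set i : 'I_(m + k) | (i < m)%N].

Lemma corner1_setmx : corner k (1%:M : 'M[F]_m) = setmx F M.
Proof.
rewrite /corner -!diag_const_mx -[X in block_mx _ _ _ X](raddf0 (@diag_mx F k)) -diag_mx_row.
congr diag_mx; apply/rowP => i; rewrite !mxE inE.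
by case: splitP => j _; rewrite !mxE.
Qed.

Lemma block_perm (r : 'S_m) : exists2 s : 'S_(m + k),
  forall i : 'I_m, s (lshift k i) = lshift k (r i)
  & perm_mx s = block_mx (perm_mx r) 0 0 1%:M :> 'M[F]_(m + k).
Proof.
pose f (i : 'I_(m + k)) := match split i with
  inl j => lshift k (r j) | inr j => rshift m j end.
have fl (i : 'I_m) : f (lshift k i) = lshift k (r i) by rewrite /f (unsplitK (inl i)).
have fr (i : 'I_k) : f (rshift m i) = rshift m i by rewrite /f (unsplitK (inr i)).
have finj : injective f.
  move=> i j; case: (split_ordP i) => i' ->; case: (split_ordP j) => j' ->;
    rewrite ?fl ?fr => /eqP; rewrite ?eq_lrshift ?eq_rlshift // ?(inj_eq (@lshift_inj _ _)).
    by rewrite (inj_eq perm_inj) => /eqP ->.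
  by move/eqP.
exists (perm finj) => [i|]; first by rewrite permE fl.
apply/matrixP => i j; rewrite [LHS]mxE [LHS]mxE permE.
by case: (split_ordP i) => i' ->; case: (split_ordP j) => j' ->;
  rewrite ?fl ?fr ?(block_mxEul, block_mxEur, block_mxEdl, block_mxEdr) !mxE
    ?eq_lrshift ?eq_rlshift ?(inj_eq (@lshift_inj _ _)) ?(inj_eq (@rshift_inj _ _)).
Qed.

Lemma dim_Sn_invariants_corner_ge d : (d <= m)%N ->
  (forall s x, s != 0 -> sigma s%:M x = s ^+ d *: x) ->
  (\dim (Sn_invariants sigma) <= \dim (Sn_invariants (corner_repr sigma)))%N.
Proof.
move=> dm hom; apply: (@dim_le_of_inj _ _ _ (sigma (corner k 1%:M))) => x /Sn_invariantsP xinv.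
  apply/Sn_invariantsP => r; have [s _ Es] := block_perm r.
  rewrite /corner_repr -(monoid_reprM Hsigma) -cornerM mulmx1.
  by rewrite -(corner1_mul _ 1%:M) -Es (monoid_reprM Hsigma) xinv.
rewrite corner1_setmx => xM.
apply: (homogeneous_eq0 Hsigma _ hom) => [|A Ad]; first by rewrite sigma1 lfunE.
have [s Hs] := perm_into (leq_addr k m) (leq_trans Ad dm).
have sAM : s @: A \subset M by apply/subsetP => _ /imsetP[i iA ->]; rewrite inE Hs.
(* Invariance trades [setmx A] for [setmx (s @: A)], which factors through [setmx M] and so kills
   [x]. *)
rewrite -{1}(xinv s) -(monoid_reprM Hsigma) setmx_perm (monoid_reprM Hsigma).
by rewrite -(setIidPl sAM) -setmxI (monoid_reprM Hsigma) xM !linear0.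
Qed.

(** After multiplication by [setmx A] only the rows of [perm_mx s] in [A] count. There [s] agrees
    with a permutation coming from ['S_m], which fixes [u]. *)
Lemma setmx_average_corner (A : {set 'I_(m + k)}) (s : 'S_(m + k)) u :
  u \in Sn_invariants (corner_repr sigma) -> A \subset M -> s @: A \subset M ->
  sigma (setmx F A) (sigma (perm_mx s) u) = sigma (setmx F A) u.
Proof.
move=> /Sn_invariantsP uinv AM sAM.
pose f (i : 'I_m) := insubd i (val (s (lshift k i))).
have Ef i : lshift k i \in A -> lshift k (f i) = s (lshift k i).
  move=> iA; apply: val_inj; rewrite /= val_insubd.
  have /(subsetP sAM) : s (lshift k i) \in s @: A by apply: imset_f.
  by rewrite inE => ->.
have [|r Hr] := @perm_extension _ [set i | lshift k i \in A] f.
  move=> i j; rewrite !inE => iA jA /(congr1 (lshift k)).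
  by rewrite !Ef // => /perm_inj/lshift_inj.
have [s' Hs' Es'] := block_perm r.
have u1 : sigma (corner k 1%:M) u = u by rewrite -{2}(uinv 1%g) perm_mx1.
rewrite -(monoid_reprM Hsigma).
have -> : setmx F A *m perm_mx s = setmx F A *m perm_mx s'.
  rewrite !mul_diag_mx; apply/matrixP => i j; rewrite !mxE.
  have [iA|_] := boolP (i \in A); last by rewrite !mul0r.
  have [i0 Ei] : exists i0, i = lshift k i0.
    by have := subsetP AM i iA; rewrite inE => im; exists (Ordinal im); apply: val_inj.
  by rewrite Ei in iA *; rewrite Hs' Hr ?Ef ?inE.
rewrite (monoid_reprM Hsigma) -{1}u1 Es' -(monoid_reprM Hsigma (block_mx _ _ _ _)).
by rewrite mul_corner1 [sigma (corner _ _) u]uinv.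
Qed.

Lemma dim_Sn_invariants_corner_le :
  (\dim (Sn_invariants (corner_repr sigma)) <= \dim (Sn_invariants sigma))%N.
Proof.
pose T := \sum_(s : 'S_(m + k)) sigma (perm_mx s).
apply: (@dim_le_of_inj _ _ _ T) => u uinv.
  apply/Sn_invariantsP => s; rewrite sum_lfunE linear_sum /=.
  rewrite [RHS](reindex_inj (mulgI s)) /=; apply: eq_bigr => s' _.
  by rewrite -(monoid_reprM Hsigma) -perm_mxM.
move=> Tu.
have u1 : sigma (setmx F M) u = u.
  by move/Sn_invariantsP: uinv => uinv; rewrite -corner1_setmx -{2}(uinv 1%g) perm_mx1.
suff H (A : {set 'I_(m + k)}) : A \subset M -> sigma (setmx F A) u = 0 by rewrite -u1 H.
move cA: #|A| => c; elim/ltn_ind: c A cA => c IH A cA AM.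
pose N := #|[set s : 'S_(m + k) | s @: A \subset M]|.
have : sigma (setmx F A) (T u) = N%:R *: sigma (setmx F A) u.
  (* Permutations keeping [A] inside [M] each contribute [sigma (setmx F A) u]. Any other
     contributes the image of [u] under the strictly smaller set [(s @: A) :&: M], up to a
     permutation, which is 0 by induction. *)
  rewrite sum_lfunE linear_sum /= (bigID (fun s : 'S_(m + k) => s @: A \subset M)) /=.
  rewrite [X in _ + X]big1 => [|s sAM].
    rewrite addr0 (eq_bigr (fun=> sigma (setmx F A) u)) => [|s]; last first.
      exact: setmx_average_corner.
    by rewrite sumr_const -scaler_nat /N cardsE.
  rewrite -(monoid_reprM Hsigma) setmx_perm (monoid_reprM Hsigma).
  rewrite -{1}u1 -(monoid_reprM Hsigma (setmx _ _)) setmxI.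
  rewrite (IH _ _ _ erefl) ?linear0 ?subsetIr //.
  rewrite -cA -(card_imset A (@perm_inj _ s)) proper_card // properE subsetIl.
  by rewrite subsetI subxx.
rewrite Tu linear0 => /esym/eqP; rewrite scaler_eq0 Num.Theory.pnatr_eq0.
(* The count [N] is positive because the identity permutation keeps [A] inside [M]. *)
case/orP=> [|/eqP //]; rewrite cards_eq0 => /eqP/setP/(_ 1%g).
rewrite !inE => /negP[]; apply: subset_trans AM; apply/subsetP => _ /imsetP[i iA ->].
by rewrite perm1.
Qed.

End Stabilization.

(** * Irreducible polynomial representations and their invariants *)

Section IrreducibleRepresentation.
Variable F : numFieldType.

Lemma eq_Sn_invariants n (V : vectType F) (rho rho' : 'M[F]_n -> 'End(V)) :
  {in unitmx, rho' =1 rho} -> Sn_invariants rho' = Sn_invariants rho.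
Proof. by move=> E; apply: eq_bigr => s _; rewrite E ?unitmx_perm. Qed.

Lemma irr_poly_repr_extension n (lam : seq nat) (V : vectType F) (rho : 'M[F]_n -> 'End(V)) :
  irr_poly_repr rho lam -> exists (rho' : 'M[F]_n -> 'End(V)) v,
    [/\ Sn_invariants rho = Sn_invariants rho', monoid_repr rho',
      cyclic_repr rho', hw_vector lam rho' v & rho' 1%:M = \1%VF].
Proof.
move=> [Hrho Prho irr [v [vn0 wv uv]]].
have [rho' Hrho' E] := GL_repr_extension Hrho Prho.
exists rho', v; split=> //.
- by rewrite (eq_Sn_invariants E).
- exact: irreducible_cyclic irr Hrho' E.
- split=> // [t tn0|u uu].
    by rewrite E ?wv // unitmxE det_diag unitfE; apply/prodf_neq0 => i _; apply: tn0.
  rewrite E ?uv // unitmxE -det_tr det_trig; last first.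
    by apply/is_trig_mxP => i j lt; rewrite mxE uu ?(ltnW lt) // -val_eqE gtn_eqF.
  rewrite unitfE; apply/prodf_neq0 => i _.
  by rewrite mxE uu // eqxx oner_neq0.
- by case: Hrho => <- _; rewrite E ?unitmx1.
Qed.

(** Scalar matrices are central and act on the highest weight vector by the power [sumn lam]; every
    vector is a formal sum applied to that one. *)
Lemma cyclic_homogeneous n (lam : seq nat) (V : vectType F) (rho : 'M[F]_n -> 'End(V)) v :
  (size lam <= n)%N -> monoid_repr rho -> cyclic_repr rho -> rho 1%:M = \1%VF ->
  hw_vector lam rho v -> forall s x, s != 0 -> rho s%:M x = s ^+ sumn lam *: x.
Proof.
move=> lam_n Hrho cyc rho1 [vn0 wv _] s x sn0.
have [||z <-] := cyc v x _ vn0; rewrite ?rho1 ?lfunE //.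
have sv : rho s%:M v = s ^+ sumn lam *: v.
  rewrite -diag_const_mx wv => [|i]; last by rewrite mxE.
  congr (_ *: _); rewrite (eq_bigr (fun i : 'I_n => s ^+ nth 0%N lam i)) => [|i _].
    rewrite -expr_sum; congr (_ ^+ _).
    rewrite -(big_mkord predT (nth 0%N lam)) (big_cat_nat (leq0n _) lam_n) /=.
    rewrite sumnE [RHS](big_nth 0%N) [X in (_ + X)%N]big_nat_cond.
    rewrite [X in (_ + X)%N]big1 ?addn0 // => i /andP[/andP[le _] _].
    exact: nth_default.
  by rewrite mxE.
rewrite -(formal_act_repr Hrho) /formal_mul /formal_act.
rewrite big_allpairs_dep big_seq1 scaler_sumr; apply: eq_bigr => cg _ /=.
by rewrite mul1r -scalar_mxC (monoid_reprM Hrho) sv linearZ scalerA mulrC -scalerA.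
Qed.

(** Uniqueness, applied in both directions, compares [rho] with the corner of [sigma]; truncation
    and averaging compare that corner with [sigma] itself. *)
Lemma dim_Sn_invariants_stable m k (lam : seq nat) (V W : vectType F)
    (rho : 'M[F]_m -> 'End(V)) (sigma : 'M[F]_(m + k) -> 'End(W)) :
  (size lam <= m)%N -> (sumn lam <= m)%N ->
  irr_poly_repr rho lam -> irr_poly_repr sigma lam ->
  \dim (Sn_invariants rho) = \dim (Sn_invariants sigma).
Proof.
move=> lam_size lam_sum /irr_poly_repr_extension[rho' [v [-> Hrho rho_cyc hv _]]].
move=> /irr_poly_repr_extension[sigma' [w [-> Hsigma sigma_cyc hw_ sigma1]]].
have Htau := corner_monoid_repr Hsigma.
have tau_cyc := corner_cyclic Hsigma sigma_cyc sigma1.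
have hw_tau := corner_hw_vector Hsigma lam_size hw_.
transitivity (\dim (Sn_invariants (corner_repr sigma'))).
  apply/eqP; rewrite eqn_leq (dim_Sn_invariants_le Hrho Htau hv hw_tau) //.
  exact: dim_Sn_invariants_le Htau Hrho hw_tau hv tau_cyc rho_cyc.
apply/eqP; rewrite eqn_leq dim_Sn_invariants_corner_le //=.
apply: (dim_Sn_invariants_corner_ge Hsigma sigma1 lam_sum).
apply: cyclic_homogeneous Hsigma sigma_cyc sigma1 hw_.
by rewrite (leq_trans lam_size) ?leq_addr.
Qed.

End IrreducibleRepresentation.

Theorem theorem5 (R : realType) (m n : nat) (m_gt0 : (0 < m)%N)
    (le_mn : (m <= n)%N) (lam : m.-tuple nat) (lam_dom : sorted geq lam)
    (le_lam : (sumn lam <= m)%N)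
    (V : vectType R[i]) (rho : 'M[R[i]]_m -> 'End(V))
    (rho_lam : irr_poly_repr rho lam)
    (W : vectType R[i]) (sigma : 'M[R[i]]_n -> 'End(W))
    (sigma_lam : irr_poly_repr sigma lam) :
  \dim (Sn_invariants rho) = \dim (Sn_invariants sigma).
Proof.
have [k En] : exists k, n = (m + k)%N by exists (n - m)%N; rewrite subnKC.
subst n; apply: (@dim_Sn_invariants_stable _ m k lam) => //.
by rewrite size_tuple.
Qed.
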